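(* Assume the Hypothesis stated in the context, and let also $\sigma(\mathcal L)\subseteq\mathbb R$. If the operator $\mathcal L$ is similar to a self-adjoint operator, then there is a constant $K>0$ such that $$\|(\overline{T(z)})^{-1}\|_{\mathcal H}\le\frac{K}{|\mathrm{Im}\,z|},\qquad \|A^{-1}(\overline{T(z)})^{-1}\|_{\mathcal H}\le\frac{K}{|z|\,|\mathrm{Im}\,z|}$$ for all $z\in\mathbb C\setminus\mathbb R$.
   Context: Let $\mathcal H$ be a complex separable Hilbert space, $\mathfrak H=\mathcal H\times\mathcal H$, and let $A,B,C$ be (possibly unbounded) linear operators in $\mathcal H$. For a self-adjoint operator $R$, $\kappa_-(R)=\dim\operatorname{ran}\chi_{(-\infty,0)}(R)$ (spectral projection). Hypothesis: (i) $A$ is self-adjoint with $0\in\rho(A)$ and $\kappa_-(A)<\infty$; (ii) $C$ is closed, $\mathrm{dom}(A)\subset\mathrm{dom}(C)$ and $\mathrm{dom}(A)\subset\mathrm{dom}(C^* )$; (iii) $B=B^*$; (iv) $\mathrm{dom}(S_0):=\mathrm{dom}(C^* )\cap\mathrm{dom}(B)$ is dense in $\mathcal H$, and $S_0:=B-CA^{-1}C^*$ is essentially self-adjoint on $\mathrm{dom}(S_0)$ with $\kappa_-(\overline{S_0})<\infty$. Put $\mathcal J=\begin{pmatrix}0&\mathrm i I\\-\mathrm i I&0\end{pmatrix}$. The operator $\mathcal A_0=\begin{pmatrix}A&C^*\\C&B\end{pmatrix}$ with $\mathrm{dom}(\mathcal A_0)=\mathrm{dom}(A)\times\mathrm{dom}(S_0)$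 is (under the Hypothesis, as is known) essentially self-adjoint in $\mathfrak H$; $\mathcal L_0=\mathcal J\mathcal A_0=\begin{pmatrix}\mathrm iC&\mathrm iB\\-\mathrm iA&-\mathrm iC^*\end{pmatrix}$ on the same domain. $\mathcal A$ and $\mathcal L=\mathcal J\mathcal A$ denote the closures of $\mathcal A_0$ and $\mathcal L_0$. For $z\in\mathbb C$ set $T(z)=B-(C+\mathrm i z)A^{-1}(C^*-\mathrm i z)$ with $\mathrm{dom}(T(z))=\mathrm{dom}(C^* )\cap\mathrm{dom}(B)$; the overline denotes closure. An operator $\mathcal L$ is similar to a self-adjoint operator if there is a bounded, boundedly invertible $W$ on $\mathfrak H$ such that $W\mathcal L W^{-1}$ is self-adjoint. *)

(* Defs.v *)
From HB Require Import structures.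
From mathcomp Require Import all_boot all_order all_algebra.
From mathcomp Require Import complex sesquilinear.
From mathcomp Require Import all_classical all_reals all_analysis.

Set Implicit Arguments.
Unset Strict Implicit.
Unset Printing Implicit Defensive.

Import Order.TTheory GRing.Theory Num.Theory.
Import numFieldNormedType.Exports.

Local Open Scope classical_set_scope.
Local Open Scope ring_scope.

(* A possibly unbounded linear operator
   from V to W is represented by its graph, a set of pairs in V * W; sums and
   compositions of graphs automatically carry their natural domains, and the
   closure of an operator is the topological [closure] of its graph. *)

Section Graphs.
Variables (K : pzRingType) (U V W : lmodType K).

Definition op_dom (T : set (V * W)) : set V := [set x | exists y, T (x, y)].

Definition linear_op (T : set (V * W)) : Prop :=
  [/\ T (0, 0),
      forall (a : K) x y x' y', T (x, y) -> T (x', y') ->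
        T (a *: x + x', a *: y + y')
    & forall x y y', T (x, y) -> T (x, y') -> y = y'].

Definition op_fun (f : V -> W) : set (V * W) := [set p | p.2 = f p.1].

Definition op_inv (T : set (V * W)) : set (W * V) := (T ^-1)%relation.

Definition op_comp (S : set (V * W)) (T : set (U * V)) : set (U * W) :=
  (S \; T)%relation.

Definition op_add (S T : set (V * W)) : set (V * W) :=
  [set p | exists y1 y2, [/\ S (p.1, y1), T (p.1, y2) & p.2 = y1 + y2]].

Definition op_sub (S T : set (V * W)) : set (V * W) :=
  [set p | exists y1 y2, [/\ S (p.1, y1), T (p.1, y2) & p.2 = y1 - y2]].

End Graphs.

Definition op_scalar {K : pzRingType} {V : lmodType K} (z : K) : set (V * V) :=
  op_fun (fun x : V => z *: x).

(* [[T11, T12], [T21, T22]] acting on columns; its domain is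
   (dom T11 `&` dom T21) x (dom T12 `&` dom T22). *)
Definition op_block {K : pzRingType} {V : lmodType K}
    (T11 T12 T21 T22 : set (V * V)) : set ((V * V) * (V * V)) :=
  [set p | exists a b c d,
     [/\ T11 (p.1.1, a), T12 (p.1.2, b), T21 (p.1.1, c), T22 (p.1.2, d)
       & p.2 = (a + b, c + d)]].

Definition has_dim {K : pzRingType} {V : lmodType K} (X : set V) (n : nat) :
    Prop :=
  exists e : 'I_n -> V,
    (forall x, X x <-> exists c : 'I_n -> K, x = \sum_i c i *: e i) /\
    (forall c : 'I_n -> K, \sum_i c i *: e i = 0 -> forall i, c i = 0).

Definition separable (T : topologicalType) : Prop :=
  exists2 D : set T, countable D & dense D.

Section Operators.
Variable R : realType.
Local Notation C := R[i].

(* Norms over the numField R[i] take their values in R[i]. *)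
Definition rnorm (V : normedZmodType C) (x : V) : R := complex.Re `|x|.

Section Norm.
Variables V W : normedModType C.

Definition opnorm (T : set (V * W)) : \bar R :=
  ereal_sup [set t | exists x y, [/\ T (x, y), rnorm x <= 1
                                   & t = (rnorm y)%:E]].

Definition bounded_op (T : set (V * W)) : Prop :=
  [/\ linear_op T, op_dom T = setT & (opnorm T < +oo)%E].

End Norm.

Section Spectrum.
Variable V : normedModType C.

Definition boundedly_invertible_op (T : set (V * V)) : Prop :=
  bounded_op T /\ bounded_op (op_inv T).

Definition resolvent_set (T : set (V * V)) : set C :=
  [set z | bounded_op (op_inv (op_sub T (op_scalar z)))].

Definition spectrum (T : set (V * V)) : set C := ~` resolvent_set T.

Definition closable (T : set (V * V)) : Prop := linear_op (closure T).

End Spectrum.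

(* The inner product is passed as an explicit form, linear in its first
   argument: on V * V the topology is that of the library's max norm, which is
   equivalent to, but different from, the norm of the form [prod_form]. *)
Section Adjoint.
Variables (V : normedModType C) (form : V -> V -> C).

Definition op_adjoint (T : set (V * V)) : set (V * V) :=
  [set p | forall q, T q -> form q.2 p.1 = form q.1 p.2].

Definition self_adjoint (T : set (V * V)) : Prop :=
  [/\ linear_op T, dense (op_dom T) & op_adjoint T = T].

Definition essentially_self_adjoint (T : set (V * V)) : Prop :=
  [/\ linear_op T, dense (op_dom T) & self_adjoint (closure T)].

Definition similar_to_self_adjoint (T : set (V * V)) : Prop :=
  exists W : set (V * V), boundedly_invertible_op W /\
    self_adjoint (op_comp W (op_comp T (op_inv W))).

Definition orthogonal_projection (P : V -> V) : Prop :=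
  [/\ linear P, forall x, P (P x) = P x
    & forall x y, form (P x) y = form x (P y)].

Definition projection_valued_measure (E : set R -> V -> V) : Prop :=
  [/\ forall X, measurable X -> orthogonal_projection (E X),
      forall x, E setT x = x
    & forall F : nat -> set R, (forall n, measurable (F n)) -> trivIset setT F ->
        forall x, (fun n => \sum_(0 <= k < n) E (F k) x) @ \oo -->
                  E (\bigcup_k F k) x].

(* E is the spectral measure of T, that is T is the integral of t dE(t): with
   mu_x (X) = <E(X) x, x>, the domain of T is {x | t^2 is mu_x-integrable} and
   <T x, x> is the integral of t dmu_x(t) on that domain, which determines T by
   polarization. *)
Definition spectral_measure_of (T : set (V * V)) (E : set R -> V -> V) : Prop :=
  projection_valued_measure E /\
  forall x : V, exists mu : {measure set R -> \bar R},
    [/\ forall X, measurable X -> mu X = (complex.Re (form (E X x) x))%:E,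
        op_dom T x <-> (\int[mu]_t (t ^+ 2)%:E < +oo)%E
      & forall y, T (x, y) -> form y x = (\int[mu]_t t)%:C%C].

(* kappa_-(T) = n : the range of the spectral projection of T on ]-oo, 0[ has
   dimension n. *)
Definition kappa_minus (T : set (V * V)) (n : nat) : Prop :=
  exists2 E, spectral_measure_of T E & has_dim (range (E `]-oo, (0 : R)[%classic)) n.

Definition kappa_minus_finite (T : set (V * V)) : Prop :=
  exists n, kappa_minus T n.

End Adjoint.

Definition prod_form (V : Type) (form : V -> V -> C) (u v : V * V) : C :=
  form u.1 v.1 + form u.2 v.2.

Section Block.
Variables (H : normedModType C) (form : H -> H -> C).
Implicit Types A B Cop : set (H * H).

Definition schur_op A B Cop : set (H * H) :=
  op_sub B (op_comp Cop (op_comp (op_inv A) (op_adjoint form Cop))).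

(* The domain of [schur_op A B Cop] is dom(Cop^* ) `&` dom(B), because A^-1 is
   defined on all of H and dom(A) `<=` dom(Cop). *)
Record block_hypothesis A B Cop : Prop := BlockHypothesis {
  A_self_adjoint : self_adjoint form A;
  A_resolvent0 : resolvent_set A 0;
  A_kappa : kappa_minus_finite form A;
  C_linear : linear_op Cop;
  C_closed : closed Cop;
  domA_domC : op_dom A `<=` op_dom Cop;
  domA_domCadj : op_dom A `<=` op_dom (op_adjoint form Cop);
  B_self_adjoint : self_adjoint form B;
  domS_dense : dense (op_dom (op_adjoint form Cop) `&` op_dom B);
  S_ess_self_adjoint : essentially_self_adjoint form (schur_op A B Cop);
  S_kappa : kappa_minus_finite form (closure (schur_op A B Cop))
}.

Definition block_J : set ((H * H) * (H * H)) :=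
  op_fun (fun p : H * H => ('i%C *: p.2, - ('i%C *: p.1))).

Definition block_A0 A B Cop : set ((H * H) * (H * H)) :=
  op_block A (op_adjoint form Cop) Cop B.

Definition block_L0 A B Cop : set ((H * H) * (H * H)) :=
  op_comp block_J (block_A0 A B Cop).

(* As J is a homeomorphism, this is also J composed with the closure of
   [block_A0]. *)
Definition block_L A B Cop : set ((H * H) * (H * H)) :=
  closure (block_L0 A B Cop).

(* T(z) = B - (C + iz) A^-1 (C^* - iz), on the domain of [schur_op]. *)
Definition op_T A B Cop (z : C) : set (H * H) :=
  op_sub B (op_comp (op_add Cop (op_scalar ('i%C * z)))
             (op_comp (op_inv A)
               (op_sub (op_adjoint form Cop) (op_scalar ('i%C * z))))).

End Block.

End Operators.

(* Main.v *)
From HB Require Import structures.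
Require Import Defs.
From mathcomp Require Import all_boot all_order all_algebra.
From mathcomp Require Import complex sesquilinear.
From mathcomp Require Import all_classical all_reals all_analysis.
From mathcomp Require Import ring lra.
Set Implicit Arguments.
Unset Strict Implicit.
Unset Printing Implicit Defensive.
Import Order.TTheory GRing.Theory Num.Theory.
Import numFieldNormedType.Exports.
Local Open Scope classical_set_scope.
Local Open Scope ring_scope.

(** The equation (L0 - z)(x, y) = (f, g) for the block operator can be solved
for x in its second row, x = A^-1 (ig - (C' - iz) y), where C' is the adjoint
of C; substituting in the first row leaves
  T(z) y = - i (f + (C + iz) A^-1 g).
So, up to a factor i, the inverse of T(z) is a corner of the resolvent of L,
and it inherits the bound of that resolvent.

This becomes a proof for unbounded operators and closures as follows.

The operator D = C A^-1 is bounded: it is everywhere defined and has a densely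
defined adjoint (hellinger_toeplitz, deduced from lsc_seminorm_bounded).
Consequently the elimination formulas pass to closures, and A^-1 C' is bounded
by the same constant (Ainv_Cadj_bound).

If L is similar to a self-adjoint operator, then |Im z| |u| <= K |(L - z) u|
on the domain of L (similar_resolvent). As z is not real it belongs to the
resolvent set, so L - z is also onto; this gives surjectivity of the closure
of T(z) (clT_surj).

The solution of (L - z)(x, y) = (ih, 0) satisfies iz A^-1 y = x + A^-1 C' y.
Both x and y are bounded by K |h| / |Im z|, hence so is |z| |A^-1 y|, up to the
factor 1 + |D|; this is the second inequality (T_est, clT_est).

That the closure of T(z) is an operator follows from T(conj z) being contained
in the adjoint of T(z) (T_adjoint, T_closable). *)

(** * The norm as a real number *)

Section RealNorm.
Variable R : realType.
Local Notation C := R[i].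

Section Base.
Variable V : normedZmodType C.
Implicit Types x y : V.

Lemma normE x : `|x| = (rnorm x)%:C%C.
Proof. by apply/esym/RRe_real; rewrite realE normr_ge0. Qed.

Lemma rnorm_ge0 x : 0 <= rnorm x.
Proof. by rewrite -ler0c -normE normr_ge0. Qed.

Lemma rnorm0 : rnorm (0 : V) = 0.
Proof. by rewrite /rnorm normr0. Qed.

Lemma rnorm0_eq0 x : rnorm x = 0 -> x = 0.
Proof. by move=> x0; apply/eqP; rewrite -normr_eq0 normE x0. Qed.

Lemma rnormD x y : rnorm (x + y) <= rnorm x + rnorm y.
Proof. by rewrite -lecR rmorphD /= -!normE ler_normD. Qed.

Lemma rnormN x : rnorm (- x) = rnorm x.
Proof. by rewrite /rnorm normrN. Qed.

Lemma rnormB x y : rnorm (x - y) <= rnorm x + rnorm y.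
Proof. by rewrite -(rnormN y) rnormD. Qed.

Lemma rdistC x y : rnorm (x - y) = rnorm (y - x).
Proof. by rewrite -rnormN opprB. Qed.

Lemma rnorm_le_dist x y : rnorm x <= rnorm y + rnorm (x - y).
Proof. by rewrite -[X in rnorm X <= _](subrKC y) rnormD. Qed.

End Base.

Lemma rnormM (a b : C) : rnorm (a * b) = rnorm a * rnorm b.
Proof. by apply: complexI; rewrite rmorphM /= -!normE normrM. Qed.

Lemma rnormZ (V : normedModType C) (a : C) (x : V) :
  rnorm (a *: x) = rnorm a * rnorm x.
Proof. by apply: complexI; rewrite rmorphM /= -!normE normrZ. Qed.

Lemma rnorm_real (a : R) : rnorm a%:C%C = `|a|.
Proof. by rewrite /rnorm normc_def /= expr0n addr0 sqrtr_sqr. Qed.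

Lemma rnormi : rnorm ('i%C : C) = 1.
Proof. by rewrite /rnorm normc_def /= expr0n add0r expr1n sqrtr1. Qed.

Lemma normr_Im_le (a : C) : `|complex.Im a| <= rnorm a.
Proof.
rewrite /rnorm normc_def /= -sqrtr_sqr ler_sqrt; last first.
  by rewrite addr_ge0 ?sqr_ge0.
by rewrite lerDr sqr_ge0.
Qed.

Section Pairs.
Variables V W : normedModType C.

Lemma rnorm_pair_le (p : V * W) (e : R) :
  (rnorm p <= e) = (rnorm p.1 <= e) && (rnorm p.2 <= e).
Proof.
rewrite -!lecR -!normE prod_normE comparable_ge_max //.
by apply: real_comparable; apply: normr_real.
Qed.

Lemma rnorm_fst (p : V * W) : rnorm p.1 <= rnorm p.
Proof. by have := lexx (rnorm p); rewrite rnorm_pair_le => /andP[]. Qed.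

Lemma rnorm_snd (p : V * W) : rnorm p.2 <= rnorm p.
Proof. by have := lexx (rnorm p); rewrite rnorm_pair_le => /andP[]. Qed.
End Pairs.

(** * Closures and approximation *)

Section Closure.
Variable V : normedModType C.

Lemma nbhs_rnormP (x : V) (S : set V) :
  nbhs x S <-> exists2 e : R, 0 < e & forall y, rnorm (y - x) < e -> S y.
Proof.
split=> [/nbhs_ballP[e /= e0 xS]|[e e0 xS]].
  have ee : e = (complex.Re e)%:C%C by apply/esym/RRe_real/gtr0_real.
  exists (complex.Re e) => [|y yx]; first by rewrite -ltcR -ee.
  by apply: xS; rewrite -ball_normE /= distrC normE ee ltcR.
apply/nbhs_ballP; exists e%:C%C; rewrite /= ?ltcR // => y.
by rewrite -ball_normE /= distrC normE ltcR; exact: xS.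
Qed.

Lemma closure_rnormP (S : set V) (x : V) :
  closure S x <-> forall e : R, 0 < e -> exists2 y, S y & rnorm (y - x) < e.
Proof.
split=> [clS e e0|clS B /nbhs_rnormP[e e0 xB]].
  have /clS[y [Sy]] : nbhs x [set y | rnorm (y - x) < e].
    by apply/nbhs_rnormP; exists e.
  by exists y.
by have [y Sy yx] := clS e e0; exists y; split=> //; exact: xB.
Qed.

Lemma dense_closure (S : set V) (x : V) : dense S -> closure S x.
Proof.
move=> dS B; rewrite nbhsE => -[U [Uo Ux] UB].
have [|y [Uy Sy]] := dS U _ Uo; first by exists x.
by exists y; split=> //; exact: UB.
Qed.

(** With F the difference of the two sides of an inequality, this carries the
inequality from an operator to its closure. *)
Lemma closure_le0 (S : set V) (F : V -> R) (M : R) (x : V) :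
  (forall y z, F y <= F z + M * rnorm (y - z)) ->
  (forall y, S y -> F y <= 0) -> closure S x -> F x <= 0.
Proof.
move=> lipF FS /closure_rnormP clS; apply/ler_addgt0Pl => e e0.
have M0 : 0 < `|M| + 1 by rewrite ltr_wpDl.
have [y Sy yx] := clS (e / (`|M| + 1)) (divr_gt0 e0 M0).
rewrite addr0 (le_trans (lipF x y)) // -[leRHS]add0r lerD ?FS //.
rewrite rdistC; rewrite ltr_pdivlMr // in yx.
rewrite (le_trans _ (ltW yx))// mulrC ler_wpM2l ?rnorm_ge0//.
by rewrite (le_trans (ler_norm M))// lerDl.
Qed.

End Closure.

(** A Lipschitz map that sends one graph into another does so for the closures;
applied to graphs, this replaces limits of sequences of approximants. *)
Lemma closure_image (V W : normedModType C) (f : V -> W) (M : R)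
    (S : set V) (T : set W) (x : V) :
  (forall y z, rnorm (f y - f z) <= M * rnorm (y - z)) ->
  (forall y, S y -> T (f y)) -> closure S x -> closure T (f x).
Proof.
move=> lipf fS /closure_rnormP clS; apply/closure_rnormP => e e0.
have M0 : 0 < `|M| + 1 by rewrite ltr_wpDl.
have [y Sy yx] := clS (e / (`|M| + 1)) (divr_gt0 e0 M0).
exists (f y); first exact: fS.
rewrite (le_lt_trans (lipf y x))//; rewrite ltr_pdivlMr // in yx.
rewrite (le_lt_trans _ yx)// mulrC ler_wpM2l ?rnorm_ge0//.
by rewrite (le_trans (ler_norm M))// lerDl.
Qed.

(** * Closed sublevel sets make a seminorm bounded *)

Section Gelfand.
Variables (V : completeNormedModType C) (q : V -> R).

Hypothesis qD : forall x y, q (x + y) <= q x + q y.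
Hypothesis qZ : forall (a : C) x, q (a *: x) = rnorm a * q x.
Hypothesis q_lsc : forall c, closed [set x | q x <= c].

Let qN x : q (- x) = q x.
Proof. by rewrite -scaleN1r qZ rnormN /rnorm normr1 mul1r. Qed.

Let q0 : q 0 = 0.
Proof. by rewrite -(scale0r 0) qZ rnorm0 mul0r. Qed.

Let unbounded := ~ exists M : R, forall x, q x <= M * rnorm x.

(* An unbounded q exceeds n at some small v; since 2 v is the difference of
   s.1 + v and s.1 - v, it also exceeds n at one of these two points, and by
   semicontinuity on a whole ball around it. *)
Let refine (n : nat) (s : V * R) : unbounded -> 0 < s.2 ->
  exists t : V * R, [/\ 0 < t.2, t.2 <= s.2 / 2, rnorm (t.1 - s.1) <= s.2 / 2
    & forall y, rnorm (y - t.1) <= t.2 -> n%:R < q y].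
Proof.
move=> ub s0.
have [v [vs qv]] : exists v, rnorm v <= s.2 / 2 /\ n%:R < q v.
  apply/not_existsP => noV; apply: ub; exists (n%:R / (s.2 / 2)) => x.
  have [x0|x0] := eqVneq (rnorm x) 0.
    by rewrite (rnorm0_eq0 x0) q0 rnorm0 mulr0.
  have xp : 0 < rnorm x by rewrite lt_neqAle eq_sym x0 rnorm_ge0.
  pose a : R := s.2 / 2 / rnorm x.
  have a0 : 0 < a by rewrite !divr_gt0.
  have := noV (a%:C%C *: x); rewrite rnormZ qZ rnorm_real gtr0_norm //.
  move=> /not_andP[]; first by rewrite divfK.
  move=> /negP; rewrite -leNgt mulrC -ler_pdivlMr // => /le_trans; apply.
  by rewrite /a invf_div [leRHS]mulrAC mulrA.
have [x [xs qx]] : exists x, rnorm (x - s.1) <= s.2 / 2 /\ n%:R < q x.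
  have [h|h] := ltP n%:R (q (s.1 + v)).
    by exists (s.1 + v); rewrite addrAC subrr add0r.
  exists (s.1 - v); rewrite addrAC subrr add0r rnormN; split=> //.
  have := qD (s.1 + v) (- (s.1 - v)).
  rewrite qN opprB addrC addrA subrK -mulr2n -scaler_nat qZ.
  rewrite -(rmorph_nat (real_complex R)) rnorm_real ger0_norm //; lra.
have /nbhs_rnormP[r r0 xr] : nbhs x [set y | n%:R < q y].
  have : open (~` [set y | q y <= n%:R]) by exact/closed_openC/q_lsc.
  rewrite (_ : ~` _ = [set y | n%:R < q y]); last first.
    by apply/seteqP; split=> y /=; rewrite ltNge => /negP.
  by move=> o; apply: open_nbhs_nbhs; split.
exists (x, Num.min (s.2 / 2) (r / 2)); split=> //=.
- by rewrite lt_min !divr_gt0.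
- by rewrite ge_min lexx.
- move=> y; rewrite le_min => /andP[_ yr]; apply: xr.
  by rewrite (le_lt_trans yr)// ltr_pdivrMr // mulr_natr mulr2n ltrDl.
Qed.

(** Gelfand's lemma, the form of the uniform boundedness principle used here.
If q were unbounded, repeated refinement would give nested balls with radii
tending to 0 such that q > n on the (n + 1)-st; their common point, which
exists by completeness, would have an infinite q. *)
Lemma lsc_seminorm_bounded : exists M : R, forall x, q x <= M * rnorm x.
Proof.
apply: contrapT => ub.
pose P (ns : nat * (V * R)) t := 0 < ns.2.2 ->
  [/\ 0 < t.2, t.2 <= ns.2.2 / 2, rnorm (t.1 - ns.2.1) <= ns.2.2 / 2
    & forall y, rnorm (y - t.1) <= t.2 -> ns.1%:R < q y].
have [next nextP] : {next & forall ns, P ns (next ns)}.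
  apply: boolp.choice => -[n s].
  have [s0|s0] := pselect (0 < s.2); last by exists s => /s0.
  by have [t ht] := refine n ub s0; exists t.
pose s := fix s n := if n is m.+1 then next (m, s m) else (0, 1).
have s_gt0 n : 0 < (s n).2.
  by elim: n => [|n IH] //=; have [] := nextP (n, s n) IH.
have sS n := nextP (n, s n) (s_gt0 n).
have s_small n : (s n).2 <= 2^-1 ^+ n.
  elim: n => [|n IH] //=; have [_ h _ _] := sS n.
  rewrite exprSr (le_trans h) // ler_wpM2r //.
have s_nested n k : rnorm ((s (k + n)).1 - (s n).1) + (s (k + n)).2 <= (s n).2.
  elim: k => [|k IH]; first by rewrite subrr rnorm0 add0r.
  have [_ h1 h2 _] := sS (k + n).
  have := rnormD ((s (k.+1 + n)).1 - (s (k + n)).1) ((s (k + n)).1 - (s n).1).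
  rewrite subrKA /=; lra.
have s_tail n m : (n <= m)%N -> rnorm ((s m).1 - (s n).1) <= (s n).2.
  move=> /subnK <-; have := s_nested n (m - n)%N; have := s_gt0 (m - n + n)%N.
  lra.
have : cvg ((fun n => (s n).1) @ \oo).
  apply/cauchy_cvgP/cauchy_exP => e e0.
  have ee : e = (complex.Re e)%:C%C by apply/esym/RRe_real/gtr0_real.
  have {}e0 : 0 < complex.Re e by rewrite -ltcR -ee.
  pose n := (Num.truncn (complex.Re e)^-1).+1.
  exists (s n).1, n => // m nm.
  rewrite -ball_normE /= distrC normE ee ltcR.
  rewrite (le_lt_trans (s_tail n m nm)) // (le_lt_trans (s_small n)) // exprVn.
  rewrite -[ltRHS]invrK ltf_pV2 ?posrE ?exprn_gt0 ?invr_gt0 //.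
  rewrite (lt_trans (truncnS_gt _)) // -natrX ltr_nat; exact: ltn_expl.
move=> /cvg_ex[/= x sx].
have x_in n : rnorm (x - (s n).1) <= (s n).2.
  apply/ler_addgt0Pl => e e0.
  have /sx[N _ sN] : nbhs x [set y | rnorm (y - x) < e].
    by apply/nbhs_rnormP; exists e.
  have /= := sN _ (leq_maxl N n); rewrite rdistC => hN.
  have := s_tail n _ (leq_maxr N n).
  have := rnormD (x - (s (maxn N n)).1) ((s (maxn N n)).1 - (s n).1).
  rewrite subrKA; lra.
(* n is the integer part of q x plus 1; the ball on which q > n has index
   n + 1. *)
have := truncnS_gt (q x); apply/negP; rewrite -leNgt ltW //.
have [_ _ _] := sS (Num.truncn (q x)).+1; apply.
exact: (x_in (Num.truncn (q x)).+2).
Qed.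

End Gelfand.

End RealNorm.

(** * Linear relations and bounded operators *)

(** Linearity of a graph without single-valuedness: unlike the latter, it is
preserved by inverses, adjoints and closures. *)
Definition linear_rel (K : pzRingType) (V W : lmodType K) (T : set (V * W)) :
    Prop :=
  T 0 /\ forall (a : K) p q, T p -> T q -> T (a *: p + q).

Section LinearRelations.
Variables (K : pzRingType) (U V W : lmodType K).

Lemma linear_op_rel (T : set (V * W)) : linear_op T -> linear_rel T.
Proof. by move=> [T0 TD _]; split=> // a [x y] [x' y']; exact: TD. Qed.

Lemma linear_rel_op (T : set (V * W)) :
  linear_rel T -> (forall y, T (0, y) -> y = 0) -> linear_op T.
Proof.
move=> [T0 TD] Tf; split=> // [a x y x' y'|x y y' Txy Txy'].
  exact: (TD a (x, y) (x', y')).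
have := TD (-1) _ _ Txy Txy'; rewrite !scaleN1r /=.
rewrite (_ : - (x, y) + (x, y') = (0, y' - y)); last first.
  by congr pair; rewrite addrC // subrr.
by move=> /Tf/eqP; rewrite subr_eq0 => /eqP.
Qed.

Lemma linear_rel_inv (T : set (V * W)) :
  linear_rel T -> linear_rel (op_inv T).
Proof.
by move=> [T0 TD]; split=> // a [x y] [x' y']; exact: (TD a (y, x) (y', x')).
Qed.

Lemma linear_rel_comp (S : set (V * W)) (T : set (U * V)) :
  linear_rel S -> linear_rel T -> linear_rel (op_comp S T).
Proof.
move=> [S0 SD] [T0 TD]; split=> [|a p q [y Ty Sy] [y' Ty' Sy']].
  by exists 0.
exists (a *: y + y'); first exact: (TD a _ _ Ty Ty').
exact: (SD a _ _ Sy Sy').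
Qed.

Lemma linear_rel_add (S T : set (V * W)) :
  linear_rel S -> linear_rel T -> linear_rel (op_add S T).
Proof.
move=> [S0 SD] [T0 TD]; split=> [|a p q].
  by exists 0, 0; split=> //=; rewrite addr0.
move=> [y1 [y2 [Sy Ty e]]] [z1 [z2 [Sz Tz e']]].
exists (a *: y1 + z1), (a *: y2 + z2); split.
- exact: (SD a _ _ Sy Sz).
- exact: (TD a _ _ Ty Tz).
- by rewrite /= e e' scalerDr addrACA.
Qed.

Lemma linear_rel_sub (S T : set (V * W)) :
  linear_rel S -> linear_rel T -> linear_rel (op_sub S T).
Proof.
move=> [S0 SD] [T0 TD]; split=> [|a p q].
  by exists 0, 0; split=> //=; rewrite subr0.
move=> [y1 [y2 [Sy Ty e]]] [z1 [z2 [Sz Tz e']]].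
exists (a *: y1 + z1), (a *: y2 + z2); split.
- exact: (SD a _ _ Sy Sz).
- exact: (TD a _ _ Ty Tz).
- by rewrite /= e e' scalerBr opprD addrACA.
Qed.

End LinearRelations.

Lemma linear_rel_scalar (K : comPzRingType) (V : lmodType K) (z : K) :
  linear_rel (@op_scalar K V z).
Proof.
split=> [|a p q]; first by rewrite /op_scalar /op_fun /= scaler0.
by rewrite /op_scalar /op_fun /= => -> ->; rewrite scalerDr !scalerA mulrC.
Qed.

Section Bounded.
Variable R : realType.
Local Notation C := R[i].

Lemma linear_rel_closure (V W : normedModType C) (T : set (V * W)) :
  linear_rel T -> linear_rel (closure T).
Proof.
move=> [T0 TD]; split=> [|a p q clp clq]; first exact: subset_closure.
have clT r : T r -> closure T (a *: p + r).
  move=> Tr; apply: (@closure_image _ _ _ (fun p => a *: p + r) (rnorm a) T) => //.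
    by move=> y z; rewrite opprD addrACA subrr addr0 -scalerBr rnormZ.
  by move=> y Ty; exact: TD.
have /closure_id -> := @closed_closure _ T.
apply: (@closure_image _ _ _ (fun q => a *: p + q) 1 T) clq => // y z.
by rewrite opprD addrACA subrr add0r mul1r.
Qed.

Lemma bounded_op_fun (V W : normedModType C) (T : set (V * W)) :
  bounded_op T -> exists (f : {linear V -> W}) (M : R),
    [/\ 0 <= M, forall x y, T (x, y) <-> y = f x
      & forall x, rnorm (f x) <= M * rnorm x].
Proof.
move=> [[T0 TD Tf] Tdom Tb].
have [f fT] : {f & forall x, T (x, f x)}.
  apply: (@boolp.choice _ _ (fun x y => T (x, y))) => x.
  by have : setT x by []; rewrite -Tdom.
have lf : linear f by move=> a x y; apply: Tf (fT _) (TD a _ _ _ _ (fT x) (fT y)).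
pose F : {linear V -> W} := HB.pack f (GRing.isLinear.Build _ _ _ _ f lf).
have T_ub x : rnorm x <= 1 -> ((rnorm (f x))%:E <= opnorm T)%E.
  by move=> x1; apply: ereal_sup_ubound; exists x, (f x).
have M0 : (0 <= opnorm T)%E.
  have := T_ub 0; rewrite rnorm0 => /(_ ler01); apply: le_trans.
  by rewrite lee_fin rnorm_ge0.
have opE : opnorm T = (fine (opnorm T))%:E by rewrite fineK // ge0_fin_numE.
exists F, (fine (opnorm T)); split=> [|x y|x].
- exact: fine_ge0.
- by split=> [Txy|->]; [exact: Tf Txy (fT x)|exact: fT].
have [x0|x0] := eqVneq (rnorm x) 0.
  by rewrite (rnorm0_eq0 x0) linear0 !rnorm0 mulr0.
have xp : 0 < rnorm x by rewrite lt_neqAle eq_sym x0 rnorm_ge0.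
have := T_ub ((rnorm x)^-1%:C%C *: x).
rewrite rnormZ rnorm_real gtr0_norm ?invr_gt0 // mulVf // => /(_ (lexx _)).
rewrite opE lee_fin -[f]/(F : V -> W) linearZ rnormZ rnorm_real.
by rewrite gtr0_norm ?invr_gt0 // mulrC ler_pdivrMr.
Qed.

Lemma opnorm_le (V W : normedModType C) (T : set (V * W)) (M : R) :
  0 <= M -> (forall x y, T (x, y) -> rnorm y <= M * rnorm x) ->
  (opnorm T <= M%:E)%E.
Proof.
move=> M0 Tb; apply: ge_ereal_sup => _ [x [y [Txy x1 ->]]].
by rewrite lee_fin (le_trans (Tb _ _ Txy)) // ler_piMr.
Qed.

Lemma resolventP (V : normedModType C) (T : set (V * V)) (z : C) :
  resolvent_set T z -> exists (f : {linear V -> V}) (M : R),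
    [/\ 0 <= M, forall u v, T (u, v) <-> u = f (v - z *: u)
      & forall x, rnorm (f x) <= M * rnorm x].
Proof.
move=> /bounded_op_fun[f [M [M0 fP fM]]]; exists f, M; split=> // u v.
rewrite -fP; split=> [Tuv|]; first by exists v, (z *: u).
move=> [y1 [y2 [/= Ty1]]].
by rewrite /op_scalar /op_fun /= => -> /addIr ->.
Qed.

End Bounded.

(** * Inner products, adjoints and the Hellinger-Toeplitz theorem *)

Section Hilbert.
Variables (R : realType) (H : completeNormedModType R[i]).
Variable ip : {dot H for Num.conj}.
Hypothesis hnorm : forall x : H, ip x x = `|x| ^+ 2.
Local Notation C := R[i].

Lemma ipC x y : ip x y = (ip y x)^*%C.
Proof. by rewrite hermC expr0 mul1r. Qed.

Lemma ipZl a x y : ip (a *: x) y = a * ip x y.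
Proof. exact: linearZl_LR. Qed.

Lemma ipZr a x y : ip x (a *: y) = a^*%C * ip x y.
Proof. exact: linearZr_LR. Qed.

Lemma ip_rnorm x : ip x x = (rnorm x ^+ 2)%:C%C.
Proof. by rewrite hnorm normE -rmorphXn. Qed.

Lemma conj_mul (a : C) : a * a^*%C = (rnorm a ^+ 2)%:C%C.
Proof. by rewrite -sqr_normc normE -rmorphXn. Qed.

Lemma cauchy_schwarz x y : rnorm (ip x y) <= rnorm x * rnorm y.
Proof.
have [y0|y0] := eqVneq (rnorm y) 0.
  by rewrite (rnorm0_eq0 y0) linear0r !rnorm0 mulr0.
have yp : 0 < rnorm y by rewrite lt_neqAle eq_sym y0 rnorm_ge0.
(* u is |y|^2 times the component of x orthogonal to y. *)
pose u := (rnorm y ^+ 2)%:C%C *: x - ip x y *: y.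
have : 0 <= ip u u by rewrite ip_rnorm ler0c sqr_ge0.
have -> : ip u u =
    (rnorm y ^+ 2 * (rnorm x ^+ 2 * rnorm y ^+ 2 - rnorm (ip x y) ^+ 2))%:C%C.
  rewrite linearBr /= !linearBl /= !ipZl !ipZr !ip_rnorm (ipC y x).
  have Ecast (a b c : R) :
      (a * (b * a - c))%:C%C = a%:C%C * (b%:C%C * a%:C%C - c%:C%C) :> C.
    by rewrite rmorphM rmorphB rmorphM.
  rewrite conjc_real Ecast -conj_mul; ring.
rewrite ler0c pmulr_rge0 ?exprn_gt0 // subr_ge0 -exprMn.
by rewrite ler_pXn2r ?nnegrE ?mulr_ge0 ?rnorm_ge0.
Qed.

Lemma linear_rel_adjoint (T : set (H * H)) : linear_rel (op_adjoint ip T).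
Proof.
split=> [q _|a p q Tp Tq r Tr]; first by rewrite /= !linear0r.
by rewrite /= !linearDr /= !ipZr (Tp r Tr) (Tq r Tr).
Qed.

Lemma dense_orthogonal (S : set H) (x : H) :
  dense S -> (forall y, S y -> ip x y = 0) -> x = 0.
Proof.
move=> dS xS; apply: rnorm0_eq0.
have : rnorm (ip x x) <= 0.
  apply: (@closure_le0 _ _ S (fun y => rnorm (ip x y)) (rnorm x)).
  - move=> y z; rewrite (le_trans (rnorm_le_dist _ (ip x z))) // lerD2l.
    by rewrite -linearBr cauchy_schwarz.
  - by move=> y /xS ->; rewrite rnorm0.
  - exact: dense_closure.
rewrite ip_rnorm rnorm_real ger0_norm ?sqr_ge0 // => x0.
by apply/eqP; rewrite -sqrf_eq0 eq_le x0 sqr_ge0.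
Qed.

Lemma closure_adjoint (T : set (H * H)) (p q : H * H) :
  closure T p -> (forall t, T t -> ip t.2 q.1 = ip t.1 q.2) ->
  ip p.2 q.1 = ip p.1 q.2.
Proof.
move=> clp Tq; apply/eqP; rewrite -subr_eq0; apply/eqP/rnorm0_eq0/le_anti.
rewrite rnorm_ge0 andbT.
apply: (@closure_le0 _ _ T (fun t => rnorm (ip t.2 q.1 - ip t.1 q.2))
  (rnorm q.1 + rnorm q.2)) clp => [y z|t /Tq ->]; last by rewrite subrr rnorm0.
rewrite (le_trans (rnorm_le_dist _ (ip z.2 q.1 - ip z.1 q.2))) // lerD2l.
rewrite opprD addrACA -opprD -!linearBl (le_trans (rnormB _ _)) // mulrDl lerD //.
- rewrite (le_trans (cauchy_schwarz _ _)) // mulrC ler_wpM2l ?rnorm_ge0 //.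
  exact: (rnorm_snd (y - z)).
- rewrite (le_trans (cauchy_schwarz _ _)) // mulrC ler_wpM2l ?rnorm_ge0 //.
  exact: (rnorm_fst (y - z)).
Qed.

(** The bound comes from Gelfand's lemma for the seminorm |D x|: if |D y| <= c
for all y in a set and x is in its closure, then |<D x, u>| <= c |u| for u in
S, because <D x, u> = <x, u'> is continuous in x; this extends to all u by
density, and u = D x gives |D x| <= c. *)
Lemma hellinger_toeplitz (D : {linear H -> H}) (S : set H) :
  dense S ->
  (forall y, S y -> exists y', forall x, ip (D x) y = ip x y') ->
  exists M : R, forall x, rnorm (D x) <= M * rnorm x.
Proof.
move=> dS DS; apply: lsc_seminorm_bounded => [x y|a x|c].
- by rewrite linearD rnormD.
- by rewrite linearZ rnormZ.
move=> x clx.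
have c0 : 0 <= c.
  have [y [yc _]] := clx setT filterT.
  exact: le_trans (rnorm_ge0 _) yc.
have Dx_le w : rnorm (ip (D x) w) <= c * rnorm w.
  rewrite -subr_le0.
  apply: (@closure_le0 _ _ S (fun y => rnorm (ip (D x) y) - c * rnorm y)
    (rnorm (D x) + c)); last exact: dense_closure.
    move=> u v.
    have := rnorm_le_dist (ip (D x) u) (ip (D x) v).
    rewrite -linearBr; have := cauchy_schwarz (D x) (u - v).
    have := ler_wpM2l c0 (rnorm_le_dist v u); rewrite (rdistC v u); lra.
  move=> u /DS[u' Du]; rewrite Du.
  apply: (@closure_le0 _ _ [set x | rnorm (D x) <= c]
    (fun x => rnorm (ip x u') - c * rnorm u) (rnorm u')) clx.
    move=> y z; have := rnorm_le_dist (ip y u') (ip z u').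
    rewrite -linearBl; have := cauchy_schwarz (y - z) u'; lra.
  move=> z /= zc; rewrite -Du subr_le0 (le_trans (cauchy_schwarz _ _)) //.
  by rewrite ler_wpM2r ?rnorm_ge0.
move=> /=; have := Dx_le (D x); rewrite ip_rnorm rnorm_real ger0_norm ?sqr_ge0 //.
have [->|D0] := eqVneq (rnorm (D x)) 0; first by [].
by rewrite expr2 ler_pM2r // lt_neqAle eq_sym D0 rnorm_ge0.
Qed.

Lemma self_adjoint_sym (V : normedModType C) (form : V -> V -> C)
    (T : set (V * V)) x y x' y' :
  self_adjoint form T -> T (x, y) -> T (x', y') -> form y x' = form x y'.
Proof. by move=> [_ _ TE] Txy; rewrite -{1}TE => /(_ _ Txy). Qed.

End Hilbert.

(** * The resolvent of an operator similar to a self-adjoint one *)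

Section Resolvent.
Variables (R : realType) (H : completeNormedModType R[i]).
Variable ip : {dot H for Num.conj}.
Hypothesis hnorm : forall x : H, ip x x = `|x| ^+ 2.
Local Notation C := R[i].

(** The norm of a pair is a maximum, not the norm of the form; this is where
the constant 2 comes from. *)
Lemma prod_form_le (u v : H * H) :
  rnorm (prod_form ip u v) <= 2 * (rnorm u * rnorm v).
Proof.
rewrite (le_trans (rnormD _ _)) // mulr_natl mulr2n lerD //.
  rewrite (le_trans (cauchy_schwarz hnorm _ _)) //.
  by rewrite ler_pM ?rnorm_ge0 ?rnorm_fst.
rewrite (le_trans (cauchy_schwarz hnorm _ _)) //.
by rewrite ler_pM ?rnorm_ge0 ?rnorm_snd.
Qed.

Lemma prod_form_real (u : H * H) :
  prod_form ip u u = (rnorm u.1 ^+ 2 + rnorm u.2 ^+ 2)%:C%C.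
Proof. by rewrite /prod_form !(ip_rnorm hnorm) -rmorphD. Qed.

Lemma rnorm_pair_sqr (u : H * H) :
  rnorm u ^+ 2 <= rnorm u.1 ^+ 2 + rnorm u.2 ^+ 2.
Proof.
have [u1 u2] := (sqr_ge0 (rnorm u.1), sqr_ge0 (rnorm u.2)).
rewrite -ler_sqrt ?addr_ge0 // sqrtr_sqr ger0_norm ?rnorm_ge0 //.
rewrite rnorm_pair_le; apply/andP; split.
  by rewrite -{1}(ger0_norm (rnorm_ge0 u.1)) -sqrtr_sqr ler_sqrt ?addr_ge0 ?lerDl.
by rewrite -{1}(ger0_norm (rnorm_ge0 u.2)) -sqrtr_sqr ler_sqrt ?addr_ge0 ?lerDr.
Qed.

Lemma Im_mul_real (z : C) (a : R) : complex.Im (z * a%:C%C) = complex.Im z * a.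
Proof. by case: z => x y /=; rewrite mulr0 add0r. Qed.

(** As <N u, u> is real, the imaginary part of <(N - z) u, u> is
- (Im z) <u, u>; then apply the Cauchy-Schwarz inequality. *)
Lemma self_adjoint_resolvent (N : set ((H * H) * (H * H))) (z : C) u v :
  self_adjoint (prod_form ip) N -> N (u, v) ->
  `|complex.Im z| * rnorm u <= 2 * rnorm (v - z *: u).
Proof.
move=> sN Nuv; have sym := self_adjoint_sym sN Nuv Nuv.
have Imvu : complex.Im (prod_form ip v u) = 0.
  have : prod_form ip v u = (prod_form ip v u)^*%C.
    rewrite {1}sym /prod_form rmorphD /=; congr (_ + _); exact: ipC.
  by case: (prod_form ip v u) => x y [/= h]; lra.
have dE : prod_form ip (v - z *: u) u = prod_form ip v u - z * prod_form ip u u.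
  by rewrite /prod_form /= !linearBl /= !ipZl mulrDr opprD addrACA.
have u_ge0 := rnorm_ge0 u.
have [->|u0] := eqVneq (rnorm u) 0; first by rewrite mulr0 mulr_ge0 ?rnorm_ge0.
have up : 0 < rnorm u by rewrite lt_neqAle eq_sym u0.
rewrite -(ler_pM2r up) -mulrA -expr2 -mulrA.
apply: le_trans (prod_form_le _ _); apply: le_trans (normr_Im_le _).
rewrite dE prod_form_real raddfB /= Imvu sub0r normrN Im_mul_real normrM.
rewrite ler_wpM2l // (le_trans (rnorm_pair_sqr u)) //.
exact: ler_norm.
Qed.

(** The estimate for W L W^-1 is carried back to L by the bounds of W and of
its inverse. *)
Lemma similar_resolvent (L : set ((H * H) * (H * H))) :
  similar_to_self_adjoint (prod_form ip) L ->
  exists2 K : R, 0 <= K & forall z u v, L (u, v) ->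
    `|complex.Im z| * rnorm u <= K * rnorm (v - z *: u).
Proof.
move=> [W [[/bounded_op_fun[w [M [M0 wP wM]]]
           /bounded_op_fun[wi [Mi [Mi0 wiP wiM]]]] sN]].
exists (Mi * (2 * M)) => [|z u v Luv]; first by rewrite !mulr_ge0.
have NW : op_comp W (op_comp L (op_inv W)) (w u, w v).
  by exists v; [exists u => //=; exact/wP|exact/wP].
have := self_adjoint_resolvent z sN NW.
have -> : w v - z *: w u = w (v - z *: u).
  by rewrite linearB; congr (_ - _); rewrite linearZ_LR.
move=> est.
have uE : u = wi (w u) by apply/wiP; exact/wP.
have : `|complex.Im z| * rnorm u <= Mi * (`|complex.Im z| * rnorm (w u)).
  by rewrite mulrCA ler_wpM2l // {1}uE.
move=> /le_trans; apply; rewrite -mulrA ler_wpM2l //.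
by rewrite (le_trans est) // -mulrA ler_wpM2l.
Qed.

End Resolvent.

(** * The operators A^-1 and C A^-1 *)

Section Main.
Variables (R : realType) (H : completeNormedModType R[i]).
Variable ip : {dot H for Num.conj}.
Hypothesis hnorm : forall x : H, ip x x = `|x| ^+ 2.
Variables A B Cop : set (H * H).
Hypothesis hyp : block_hypothesis ip A B Cop.
Local Notation C := R[i].
Local Notation Cadj := (op_adjoint ip Cop).
Local Notation T := (op_T ip A B Cop).
Local Notation L := (block_L ip A B Cop).

Lemma inverse_fun : exists (Ai : {linear H -> H}) (M : R),
  [/\ 0 <= M, forall x y, A (x, y) <-> x = Ai y,
      forall x, rnorm (Ai x) <= M * rnorm x
    & forall x y, ip (Ai x) y = ip x (Ai y)].
Proof.
have [Ai [M [M0 AiP AiM]]] := resolventP (A_resolvent0 hyp).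
have AE x y : A (x, y) <-> x = Ai y by rewrite AiP scale0r subr0.
exists Ai, M; split=> // x y.
have Ax := (AE _ _).2 (erefl (Ai x)); have Ay := (AE _ _).2 (erefl (Ai y)).
by rewrite -(self_adjoint_sym (A_self_adjoint hyp) Ax Ay).
Qed.

(** C A^-1 is everywhere defined, and its adjoint is defined on the dense
domain of the adjoint of C, so the Hellinger-Toeplitz argument bounds it. *)
Lemma CAinv_fun (Ai : {linear H -> H}) :
  (forall x y, A (x, y) <-> x = Ai y) ->
  (forall x y, ip (Ai x) y = ip x (Ai y)) ->
  exists (D : {linear H -> H}) (M' : R),
  [/\ 0 <= M', forall x c, Cop (Ai x, c) <-> c = D x
    & forall x, rnorm (D x) <= M' * rnorm x].
Proof.
move=> AE Aisym; have [_ CD Cf] := C_linear hyp.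
have [D DP] : {D & forall x, Cop (Ai x, D x)}.
  apply: (@boolp.choice _ _ (fun x y => Cop (Ai x, y))) => x.
  by apply: (domA_domC hyp); exists x; exact/AE.
have lD : linear D.
  move=> a x y; apply: Cf (DP _) _; rewrite linearP; exact: CD.
pose F : {linear H -> H} := HB.pack D (GRing.isLinear.Build _ _ _ _ D lD).
have [|M' FM'] := hellinger_toeplitz (D := F) hnorm (domS_dense hyp).
  move=> y [[s Cys] _]; exists (Ai s) => x; rewrite -Aisym.
  exact: (Cys (Ai x, D x)).
exists F, `|M'|; split=> // [x c|x].
  by split=> [h|->]; [exact: Cf h (DP x)|exact: DP].
by rewrite (le_trans (FM' x)) // ler_wpM2r ?rnorm_ge0 ?ler_norm.
Qed.

(** * The Schur complement T(z) and the block operator *)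

(** From here on Ai stands for A^-1 and D for C A^-1. *)
Section Data.
Variables (Ai D : {linear H -> H}) (MA MD : R).
Hypothesis MA0 : 0 <= MA.
Hypothesis AE : forall x y, A (x, y) <-> x = Ai y.
Hypothesis AiM : forall x, rnorm (Ai x) <= MA * rnorm x.
Hypothesis Aisym : forall x y, ip (Ai x) y = ip x (Ai y).
Hypothesis MD0 : 0 <= MD.
Hypothesis DE : forall x c, Cop (Ai x, c) <-> c = D x.
Hypothesis DM : forall x, rnorm (D x) <= MD * rnorm x.

Lemma Cadj_D y s x : Cadj (y, s) -> ip (D x) y = ip (Ai x) s.
Proof. by move=> /(_ (Ai x, D x)); apply; exact/DE. Qed.

(** The adjoint of C followed by A^-1 is contained in the adjoint of D, hence
it has the same bound as D. *)
Lemma Ainv_Cadj_bound y s : Cadj (y, s) -> rnorm (Ai s) <= MD * rnorm y.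
Proof.
move=> Cys; have := ip_rnorm hnorm (Ai s).
rewrite -Aisym -(Cadj_D _ Cys) => /(congr1 (@rnorm R C)).
rewrite rnorm_real ger0_norm ?sqr_ge0 // => e.
have := cauchy_schwarz hnorm (D (Ai s)) y; rewrite e.
have [->|As0] := eqVneq (rnorm (Ai s)) 0.
  by rewrite mulr_ge0 ?rnorm_ge0.
have Asp : 0 < rnorm (Ai s) by rewrite lt_neqAle eq_sym As0 rnorm_ge0.
move=> h; rewrite -(ler_pM2r Asp) -expr2 (le_trans h) //.
by rewrite mulrAC ler_wpM2r ?rnorm_ge0.
Qed.

(** The bounded operator (C + iz) A^-1. *)
Definition CAz (z : C) (x : H) : H := D x + ('i%C * z) *: Ai x.

Lemma CAz_is_linear z : linear (CAz z).
Proof.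
by move=> a x y; rewrite /CAz !linearP /= scalerDr addrACA.
Qed.
HB.instance Definition _ z := GRing.isLinear.Build _ _ _ _ (CAz z) (CAz_is_linear z).

Lemma CAz_bound z x : rnorm (CAz z x) <= (MD + rnorm z * MA) * rnorm x.
Proof.
rewrite (le_trans (rnormD _ _)) // mulrDl lerD // rnormZ rnormM rnormi mul1r.
by rewrite -mulrA ler_wpM2l ?rnorm_ge0.
Qed.

(** Since A^-1 maps into dom(A), which is contained in dom(C), only B and the
adjoint of C restrict the domain of T(z). *)
Lemma op_TP z y h : T z (y, h) <-> exists b s,
  [/\ B (y, b), Cadj (y, s) & h = b - CAz z (s - ('i%C * z) *: y)].
Proof.
split.
  move=> [b [e [/= Byb [a [t [s [s' [/= Cys s'E tE]]] /AE aE] Ce] hE]]].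
  move: Ce => [c [c' [/= Cac c'E eE]]]; exists b, s; split=> //.
  rewrite /op_scalar /op_fun /= in s'E c'E.
  rewrite /= in aE; rewrite aE in Cac c'E.
  by rewrite hE eE c'E ((DE _ _).1 Cac) tE s'E.
move=> [b [s [Byb Cys ->]]].
exists b, (CAz z (s - ('i%C * z) *: y)); split=> //.
exists (Ai (s - ('i%C * z) *: y)).
  exists (s - ('i%C * z) *: y); last exact/AE.
  by exists s, (('i%C * z) *: y).
exists (D (s - ('i%C * z) *: y)), (('i%C * z) *: Ai (s - ('i%C * z) *: y)).
by split=> //; exact/DE.
Qed.

Lemma block_L0P u v : block_L0 ip A B Cop (u, v) <-> exists a s b,
  [/\ u.1 = Ai a, Cadj (u.2, s), B (u.2, b)
    & v = ('i%C *: (D a + b), - ('i%C *: (a + s)))].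
Proof.
split.
  move=> [_ [a [s [c [b [/= Aa Cs Cc Bb ->]]]]]].
  rewrite /block_J /op_fun /= => ->; exists a, s, b; split=> //; first exact/AE.
  have e := (AE _ _).1 Aa; rewrite e in Cc.
  by rewrite ((DE _ _).1 Cc).
move=> [a [s [b [ua Cs Bb ->]]]].
exists (a + s, D a + b) => //; exists a, s, (D a), b; split=> //=.
  exact/AE.
by rewrite ua; exact/DE.
Qed.

Lemma linear_rel_T z : linear_rel (T z).
Proof.
have lC := linear_op_rel (C_linear hyp).
have lz := @linear_rel_scalar _ H ('i%C * z).
have lA : linear_rel A by have [/linear_op_rel] := A_self_adjoint hyp.
have lB : linear_rel B by have [/linear_op_rel] := B_self_adjoint hyp.
apply: linear_rel_sub => //; apply: linear_rel_comp; first exact: linear_rel_add.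
apply: linear_rel_comp; first exact: linear_rel_inv.
by apply: linear_rel_sub => //; exact: linear_rel_adjoint.
Qed.

Lemma CAz_adjoint z x y s : Cadj (y, s) ->
  ip (CAz z x) y = ip x (Ai (s - ('i%C * z^*%C) *: y)).
Proof.
move=> Cys; rewrite linearDl /= (Cadj_D _ Cys) ipZl -Aisym linearBr /= ipZr.
have -> : ('i * z^*)^*%C = - ('i * z)%C :> C.
  by case: z => a b; rewrite /=; simpc.
by rewrite mulNr opprK.
Qed.

(** T(conj z) is contained in the adjoint of T(z). Indeed B is symmetric, and
the other terms of <T(z) y, y'> and <y, T(conj z) y'> are both equal to
- <w, A^-1 w'>, where w = (C' - iz) y, w' = (C' - i conj z) y' and C' is the
adjoint of C. *)
Lemma T_adjoint z p q : T z p -> T z^*%C q -> ip p.2 q.1 = ip p.1 q.2.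
Proof.
case: p q => [y h] [y' h'] /op_TP[b [s [Byb Cys ->]]].
move=> /op_TP[b' [s' [Byb' Cys' ->]]] /=.
rewrite linearBl linearBr /= (self_adjoint_sym (B_self_adjoint hyp) Byb Byb').
rewrite (CAz_adjoint _ _ Cys') [ip y (CAz _ _)]ipC (CAz_adjoint _ _ Cys).
by rewrite conjcK -ipC Aisym.
Qed.

Lemma T_dense z : dense (op_dom (T z)).
Proof.
have -> : op_dom (T z) = op_dom Cadj `&` op_dom B; last exact: domS_dense hyp.
apply/seteqP; split=> y.
  by move=> [h /op_TP[b [s [Byb Cys _]]]]; split; [exists s|exists b].
by move=> [[s Cys] [b Byb]]; eexists; apply/op_TP; exists b, s.
Qed.

(** An operator with a densely defined adjoint is closable. *)
Lemma T_closable z : closable (T z).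
Proof.
apply: linear_rel_op; first exact/linear_rel_closure/linear_rel_T.
move=> h clh; apply: (dense_orthogonal hnorm (T_dense z^*%C)) => y [k Tyk].
have := closure_adjoint hnorm (q := (y, k)) clh.
rewrite /= linear0l; apply.
by move=> t Tt; exact: T_adjoint Tt Tyk.
Qed.

Lemma mulii (V : lmodType C) (x : V) : 'i%C *: ('i%C *: x) = - x.
Proof. by rewrite scalerA -expr2 sqr_i scaleN1r. Qed.

(** If T(z) y = h then (L0 - z)(x, y) = (ih, 0): the second row of the equation
forces x = - A^-1 (s - iz y), with s the image of y under the adjoint of C,
and the first row is then T(z) y = h multiplied by i. *)
Lemma T_to_L0 z y h : T z (y, h) -> exists x s,
  [/\ Cadj (y, s), x = ('i%C * z) *: Ai y - Ai s
    & block_L0 ip A B Cop ((x, y), ('i%C *: h, 0) + z *: (x, y))].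
Proof.
move=> /op_TP[b [s [Byb Cys ->]]]; set w := s - _.
exists (Ai (- w)), s; split=> //; first by rewrite -linearZ -linearB opprB.
apply/block_L0P; exists (- w), s, b; split=> //; congr pair => /=.
  rewrite /CAz !linearN /= opprD addrA scalerDr !scalerN -scalerA mulii opprK.
  by rewrite addrK addrC.
by rewrite add0r /w opprB subrK -scalerA mulii opprK.
Qed.

(** The first component x of the resolvent also controls A^-1 y, through
iz A^-1 y = x + A^-1 s; this is the origin of the factor 1/|z|. *)
Lemma T_L_estimate z y h :
  T z (y, h) -> exists x, L ((x, y), ('i%C *: h, 0) + z *: (x, y)) /\
   rnorm z * rnorm (Ai y) <= rnorm x + MD * rnorm y.
Proof.
move=> /T_to_L0[x [s [Cys xE Lxy]]]; exists x; split; first exact: subset_closure.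
have := Ainv_Cadj_bound Cys.
have := rnorm_le_dist (('i%C * z) *: Ai y) (Ai s).
rewrite -xE rnormZ rnormM rnormi mul1r; lra.
Qed.

(** The second component g of (f, g) = (L0 - z) u cannot be taken to be 0 here,
because it is only small for the elements of the graph of L0 that approximate
a solution of (L - z) u = (ih, 0). The value - i (f + (C + iz) A^-1 g) of T(z)
depends boundedly on (f, g), so that the formula passes to closures. *)
Lemma L0_to_T z u v : block_L0 ip A B Cop (u, v) ->
  T z (u.2, - ('i%C *: (v.1 - z *: u.1 + CAz z (v.2 - z *: u.2)))).
Proof.
move=> /block_L0P[a [s [b [-> Cs Bb ->]]]]; apply/op_TP; exists b, s.
split=> //=.
have -> : - ('i%C *: (a + s)) - z *: u.2
    = - ('i%C *: (a + (s - ('i%C * z) *: u.2))).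
  by rewrite addrA scalerBr opprB -scalerA mulii [LHS]addrC.
have -> : 'i%C *: (D a + b) - z *: Ai a = 'i%C *: (CAz z a + b).
  by rewrite /CAz addrAC [RHS]scalerDr -scalerA mulii.
set w := s - _.
have -> : CAz z (- ('i%C *: (a + w))) = - ('i%C *: (CAz z a + CAz z w)).
  by rewrite linearN linearZ linearD.
rewrite -scalerBr mulii opprK.
by rewrite opprD addrACA subrr add0r.
Qed.

(** * Estimates for the inverse of the closure of T(z) *)

Section Estimates.
Variables (K : R) (z : C).
Hypothesis K0 : 0 <= K.
Hypothesis z_nonreal : complex.Im z != 0.
Hypothesis z_res : resolvent_set L z.
Hypothesis L_est : forall u v, L (u, v) ->
  `|complex.Im z| * rnorm u <= K * rnorm (v - z *: u).

Let Im0 : 0 < `|complex.Im z|. Proof. by rewrite normr_gt0. Qed.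

Lemma T_est y h : T z (y, h) ->
  rnorm y <= K / `|complex.Im z| * rnorm h /\
  rnorm z * rnorm (Ai y) <= (1 + MD) * K / `|complex.Im z| * rnorm h.
Proof.
move=> /T_L_estimate[x [Lxy zAi]].
have := L_est Lxy; rewrite addrK mulrC -ler_pdivlMr // mulrAC => xyh.
have ihE : rnorm (('i%C *: h, 0) : H * H) <= rnorm h.
  by rewrite rnorm_pair_le /= rnormZ rnormi mul1r lexx rnorm0 rnorm_ge0.
have {ihE}xyh : rnorm ((x, y) : H * H) <= K / `|complex.Im z| * rnorm h.
  by rewrite (le_trans xyh) // ler_wpM2l // divr_ge0 // ltW.
move: xyh; rewrite rnorm_pair_le /= => /andP[xh yh]; split=> //.
have := ler_wpM2l MD0 yh.
rewrite -[(1 + MD) * K / _]mulrA mulrDl mul1r mulrDl -mulrA; lra.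
Qed.

Lemma clT_est y h : closure (T z) (y, h) ->
  rnorm y <= K / `|complex.Im z| * rnorm h /\
  rnorm z * rnorm (Ai y) <= (1 + MD) * K / `|complex.Im z| * rnorm h.
Proof.
have [c1 c2] : 0 <= K / `|complex.Im z| /\ 0 <= (1 + MD) * K / `|complex.Im z|.
  by rewrite !divr_ge0 ?mulr_ge0 ?addr_ge0 // ltW.
move: c1 c2 T_est.
move: (K / _) ((1 + MD) * K / _) => k k' k0 k'0 est cly.
split; rewrite -subr_le0.
  apply: (@closure_le0 _ _ (T z) (fun p => rnorm p.1 - k * rnorm p.2) (1 + k)) cly.
    move=> p q; have := rnorm_le_dist p.1 q.1.
    have := ler_wpM2l k0 (rnorm_le_dist q.2 p.2); rewrite (rdistC q.2).
    have := rnorm_fst (p - q); have := ler_wpM2l k0 (rnorm_snd (p - q)).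
    rewrite /=; lra.
  by move=> [y' h'] /est[+ _]; rewrite subr_le0.
apply: (@closure_le0 _ _ (T z)
  (fun p => rnorm z * rnorm (Ai p.1) - k' * rnorm p.2) (rnorm z * MA + k')) cly.
  move=> p q; have := ler_wpM2l (rnorm_ge0 z) (rnorm_le_dist (Ai p.1) (Ai q.1)).
  have := ler_wpM2l k'0 (rnorm_le_dist q.2 p.2); rewrite (rdistC q.2).
  have := ler_wpM2l k'0 (rnorm_snd (p - q)).
  have := ler_wpM2l (rnorm_ge0 z) (AiM (p - q).1).
  have := ler_wpM2l (rnorm_ge0 z) (ler_wpM2l MA0 (rnorm_fst (p - q))).
  rewrite /= linearB mulrDl mulrDr -mulrA; lra.
by move=> [y' h'] /est[_]; rewrite subr_le0.
Qed.

(** Solve (L - z) u = (ih, 0) and project the graph of L onto that of T(z)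
by the bounded map F provided by L0_to_T. *)
Lemma clT_surj h : exists y, closure (T z) (y, h).
Proof.
have [f [M [_ fP _]]] := resolventP z_res.
pose u := f ('i%C *: h, 0).
have Lu : L (u, ('i%C *: h, 0) + z *: u) by apply/fP; rewrite addrK.
exists u.2.
pose F (p : (H * H) * (H * H)) : H * H :=
  (p.1.2, - ('i%C *: (p.2.1 - z *: p.1.1 + CAz z (p.2.2 - z *: p.1.2)))).
have -> : (u.2, h) = F (u, ('i%C *: h, 0) + z *: u).
  by rewrite /F /= !addrK linear0 addr0 mulii opprK.
have subE (a b c d : H) : (a - z *: b) - (c - z *: d) = (a - c) - z *: (b - d).
  by rewrite scalerBr !opprD !opprK addrACA.
have FB p q : F p - F q = F (p - q).
  congr pair => /=; rewrite -opprD -scalerBr; congr (- (_ *: _)).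
  by rewrite opprD addrACA -linearB !subE.
pose E := MD + rnorm z * MA; pose M' := (1 + rnorm z) * (1 + E).
have z0 := rnorm_ge0 z.
have E0 : 0 <= E by rewrite addr_ge0 ?mulr_ge0.
have sub_le (a b : H) r : rnorm a <= r -> rnorm b <= r ->
    rnorm (a - z *: b) <= (1 + rnorm z) * r.
  move=> ar br; rewrite (le_trans (rnormB _ _)) // rnormZ mulrDl mul1r lerD //.
  by rewrite ler_wpM2l.
have Fb p : rnorm (F p) <= M' * rnorm p.
  have le1 (x : H * H) : rnorm x <= rnorm p -> rnorm x.1 <= rnorm p.
    exact: le_trans (rnorm_fst x).
  have le2 (x : H * H) : rnorm x <= rnorm p -> rnorm x.2 <= rnorm p.
    exact: le_trans (rnorm_snd x).
  have [p1 p2] := (rnorm_fst p, rnorm_snd p).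
  rewrite rnorm_pair_le /=; apply/andP; split.
    rewrite (le_trans (le2 _ p1)) // ler_peMl ?rnorm_ge0 // /M'.
    by rewrite -[leLHS]mul1r ler_pM // lerDl.
  rewrite rnormN rnormZ rnormi mul1r (le_trans (rnormD _ _)) //.
  have h1 := sub_le _ _ _ (le1 _ p2) (le1 _ p1).
  have h2 := sub_le _ _ _ (le2 _ p2) (le2 _ p1).
  have := CAz_bound z (p.2.2 - z *: p.1.2); have := ler_wpM2l E0 h2.
  rewrite -/E /M'; lra.
apply: (@closure_image _ _ _ F _ (block_L0 ip A B Cop)) Lu => [p q|[p q]].
  rewrite FB; exact: Fb.
exact: L0_to_T.
Qed.

End Estimates.
End Data.
End Main.

(** * Conclusion *)

Theorem lemma3p6 (R : realType) (H : completeNormedModType R[i])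
    (ip : {dot H for Num.conj})
    (hnorm : forall x : H, ip x x = `|x| ^+ 2)
    (hsep : separable H)
    (A B C : set (H * H))
    (hyp : block_hypothesis ip A B C)
    (hspec : spectrum (block_L ip A B C) `<=` [set z : R[i] | complex.Im z = 0])
    (hsim : similar_to_self_adjoint (prod_form ip) (block_L ip A B C)) :
  exists2 K : R, 0 < K &
    forall z : R[i], complex.Im z != 0 ->
      [/\ closable (op_T ip A B C z),
          bounded_op (op_inv (closure (op_T ip A B C z))),
          (opnorm (op_inv (closure (op_T ip A B C z)))
             <= (K / `|complex.Im z|)%:E)%E
        & (opnorm (op_comp (op_inv A) (op_inv (closure (op_T ip A B C z))))
             <= (K / (rnorm z * `|complex.Im z|))%:E)%E].
Proof.
have [Ai [MA [MA0 AE AiM Aisym]]] := inverse_fun hyp.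
have [D [MD [MD0 DE DM]]] := CAinv_fun hnorm hyp AE Aisym.
have [K0 K0_ge0 L_est] := similar_resolvent hnorm hsim.
pose K := (1 + MD) * K0.
have K_ge0 : 0 <= K by rewrite mulr_ge0 ?addr_ge0.
(* 1 is added only to make the constant positive. *)
exists (K + 1) => [|z Imz]; first by rewrite ltr_wpDl.
have Im0 : 0 < `|complex.Im z| by rewrite normr_gt0.
have z0 : 0 < rnorm z := lt_le_trans Im0 (normr_Im_le z).
have z_res : resolvent_set (block_L ip A B C) z.
  by apply: contrapT => /hspec; exact/eqP.
have lT := linear_rel_closure (linear_rel_T hyp z).
have est := clT_est hnorm MA0 AE AiM Aisym MD0 DE DM K0_ge0 Imz (L_est z).
have K1_ge0 : 0 <= (K + 1) / `|complex.Im z|.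
  by rewrite divr_ge0 ?addr_ge0 // ltW.
have inv_le y h : op_inv (closure (op_T ip A B C z)) (h, y) ->
    rnorm y <= (K + 1) / `|complex.Im z| * rnorm h.
  move=> /est[yh _]; rewrite (le_trans yh) // ler_wpM2r ?rnorm_ge0 //.
  rewrite ler_pM2r ?invr_gt0 // ler_wpDr // /K mulrDl mul1r lerDl.
  exact: mulr_ge0.
have inv_norm := opnorm_le K1_ge0 (fun h y => @inv_le y h).
split=> //.
- exact (T_closable hnorm hyp AE Aisym DE z).
- split.
  + apply: linear_rel_op; first exact: linear_rel_inv.
    move=> y /inv_le; rewrite rnorm0 mulr0 => y0.
    by apply/rnorm0_eq0/le_anti; rewrite y0 rnorm_ge0.
  + apply/seteqP; split=> // h _.
    exact (clT_surj MA0 AE AiM MD0 DE DM z_res h).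
  + exact: le_lt_trans inv_norm (ltry _).
- apply: opnorm_le => [|h w [y /est[_ Aiy] /AE wE]].
    exact: divr_ge0 (addr_ge0 K_ge0 ler01) (mulr_ge0 (ltW z0) (ltW Im0)).
  rewrite /= in wE Aiy; rewrite wE -(ler_pM2l z0) (le_trans Aiy) // -/K.
  have -> : rnorm z * ((K + 1) / (rnorm z * `|complex.Im z|) * rnorm h) =
      (K + 1) / `|complex.Im z| * rnorm h by field; rewrite !gt_eqF.
  by rewrite ler_wpM2r ?rnorm_ge0 // ler_pM2r ?invr_gt0 // lerDl.
Qed.
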